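(* Let $X$ be a Tychonoff cut-point space. Then $X$ is weakly orderable if and only if the Stone-Čech compactification $\beta X$ is an irreducible continuum.
   Context: A point $x$ of a connected space $X$ is a cut point if $X\setminus\{x\}$ is disconnected. A cut-point space is a connected topological space in which every point is a cut point. A continuum is a connected compact Hausdorff space; a subcontinuum is a subspace that is a continuum. A Hausdorff arc is a linearly ordered (Hausdorff) continuum, i.e. a continuum whose topology is the order topology of some linear order. A space $X$ is weakly orderable if there is a continuous one-to-one mapping of $X$ into a Hausdorff arc. A continuum $K$ is irreducible between $a$ and $b$ if no proper subcontinuum of $K$ contains both $a$ and $b$; $K$ is irreducible if it is irreducible between some two of its points. *)

(* Defs.v *)
From HB Require Import structures.
From mathcomp Require Import all_boot all_order all_algebra.
From mathcomp Require Import all_classical all_reals all_analysis.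

Set Implicit Arguments.
Unset Strict Implicit.
Unset Printing Implicit Defensive.

Import Order.TTheory GRing.Theory Num.Theory.
Import numFieldNormedType.Exports.

Local Open Scope classical_set_scope.
Local Open Scope ring_scope.

(* [uniform_separatorP] turns the separation in [completely_regular_space] into
   one by a continuous function to [0, 1]. *)
Definition tychonoff_space (X : topologicalType) : Prop :=
  completely_regular_space X /\ hausdorff_space X.

(* [connected A] is connectedness of the subspace [A]; it holds for [set0]. *)
Definition cut_point (X : topologicalType) (x : X) : Prop :=
  ~ connected (~` [set x]).

(* Spaces and continua are nonempty; [connected] alone does not ensure it. *)
Definition cut_point_space (X : topologicalType) : Prop :=
  [/\ [set: X] !=set0, connected [set: X] & forall x : X, cut_point x].

Definition continuum (X : topologicalType) : Prop :=
  [/\ [set: X] !=set0, connected [set: X], compact [set: X]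
    & hausdorff_space X].

(* [set_type K] carries the topology induced by the inclusion into [X]. *)
Definition subcontinuum (X : topologicalType) (K : set X) : Prop :=
  continuum (set_type K).

Definition irreducible_between (X : topologicalType) (a b : X) : Prop :=
  forall K : set X, subcontinuum K -> K a -> K b -> K = [set: X].

Definition irreducible_continuum (X : topologicalType) : Prop :=
  continuum X /\ exists a b : X, irreducible_between a b.

(* The topology of an [orderTopologicalType] is its order topology. *)
Definition hausdorff_arc d (L : orderTopologicalType d) : Prop := continuum L.

Definition weakly_orderable (X : topologicalType) : Prop :=
  exists d (L : orderTopologicalType d) (f : X -> L),
    [/\ hausdorff_arc L, continuous f & injective f].

Section stone_cech.
Variables (R : realType) (X : topologicalType).

Definition unit_interval : topologicalType := set_type (`[0, 1]%classic : set R).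

(* The canonical map [x |-> (f x)_f] of [X] into the cube [0, 1]^C(X, [0, 1]). *)
Definition stone_cech_eval :
    X -> prod_topology (fun _ : continuousType X unit_interval => unit_interval) :=
  join_product (fun f : continuousType X unit_interval => (f : X -> unit_interval)).

(* The Stone-Cech compactification, as the closure of the image of [X] in that
   cube. *)
Definition stone_cech : topologicalType :=
  set_type (closure (range stone_cech_eval)).

End stone_cech.

(* Main.v *)
Require Import Defs.
From HB Require Import structures.
From mathcomp Require Import all_boot all_order all_algebra.
From mathcomp Require Import all_classical all_reals all_analysis.
From mathcomp Require Import lra.

(* Both sides are equivalent to the existence of a strict total order on [X]
   whose open rays are open.

   Such an order has no extremal element because every point is a cut point.
   Ordering the open lower sets by inclusion gives an arc containing [X].
   In the Stone-Cech compactification, the closures of the two rays at [x] meet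
   at most in [x]; hence a subcontinuum joining a cluster point of the initial
   rays to a cluster point of the final rays contains every [x], so it is the
   whole space.

   Conversely, if the compactification is irreducible between [p] and [q], each
   cut [U | V] of [X] at [x] puts one of [p], [q] in the closure of [U] and the
   other in the closure of [V]; put [y < x] when [y] lies in the half of [p]. *)

Set Implicit Arguments.
Unset Strict Implicit.
Unset Printing Implicit Defensive.

Import Order.TTheory GRing.Theory Num.Theory.
Import numFieldNormedType.Exports.

Local Open Scope classical_set_scope.
Local Open Scope ring_scope.

(** * Cuts and orders with open rays *)

(** The trace of [U] on [A] is clopen in [A], since there it is the complement of the trace of
    [V]. *)
Lemma connected_sub_open (T : topologicalType) (A U V : set T) :
  connected A -> open U -> open V -> A `<=` U `|` V ->
  (forall x, A x -> U x -> V x -> False) -> A `&` U !=set0 -> A `<=` U.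
Proof.
move=> Ac oU oV AUV UV0 AU0.
have <- : A `&` U = A; last by move=> x [].
apply: Ac => //; first by exists U.
exists (~` V); first exact: open_closedC.
rewrite eqEsubset; split=> x [Ax Ux]; split=> //; first exact: UV0.
by case: (AUV _ Ax).
Qed.

(** * Subcontinua as subsets of the ambient space *)

Lemma connected_set_type (T : topologicalType) (K : set T) :
  connected [set: set_type K] <-> connected K.
Proof.
split=> Kc.
  have -> : K = set_val @` [set: set_type K].
    rewrite eqEsubset; split=> [x Kx|_ [x _ <-]]; last exact: set_valP.
    by exists (SigSub (mem_set Kx)).
  apply: connected_continuous_connected => //.
  exact/continuous_subspaceT/initial_continuous.
move=> B [b Bb] [C [C' oC' <-] BC] [D cD BD].
have [D' oD' D'E] : open (~` D) by exact: closed_openC.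
rewrite setTI in BC; rewrite setTI in BD.
have KCD x : K x -> C' x <-> ~ D' x.
  move=> Kx; pose y : set_type K := SigSub (mem_set Kx).
  have C'y : B y <-> C' x by rewrite BC.
  have D'y : D' x <-> ~ D y.
    by rewrite -[_ x]/((set_val @^-1` D') y) D'E.
  by rewrite -C'y D'y BD; split=> [?|/contrapT].
have KC' : K `<=` C'.
  apply: (connected_sub_open Kc oC' oD').
  - by move=> x Kx; case: (pselect (D' x)) => ?; [right|left; apply/KCD].
  - by move=> x Kx /(KCD _ Kx).
  - exists (val b); split; first exact: set_valP.
    by rewrite BC in Bb.
rewrite BC eqEsubset; split=> // x _.
exact/KC'/set_valP.
Qed.

Lemma compact_set_type (T : topologicalType) (K : set T) :
  compact [set: set_type K] <-> compact K.
Proof.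
have KE : K = set_val @` [set: set_type K].
  rewrite eqEsubset; split=> [x Kx|_ [x _ <-]]; last exact: set_valP.
  by exists (SigSub (mem_set Kx)).
split=> Kc.
  rewrite KE; apply: continuous_compact => //.
  exact/continuous_subspaceT/initial_continuous.
move=> F PF _; have [|x [Kx clx]] := Kc (set_val @ F) _.
  by apply: nearW => x; exact: set_valP.
pose y : set_type K := SigSub (mem_set Kx).
exists y; split=> // A B FA [_ [[C oC <-] Cy CB]].
have FA' : F (set_val @^-1` (set_val @` A)).
  by apply: filterS FA => a Aa; exists a.
have Cx : nbhs x C by apply: open_nbhs_nbhs; split.
have [_ [[a Aa <-] Ca]] := clx _ _ FA' Cx.
by exists a; split=> //; exact: CB.
Qed.

Lemma hausdorff_inj (S T : topologicalType) (f : S -> T) :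
  continuous f -> injective f -> hausdorff_space T -> hausdorff_space S.
Proof.
move=> fc fi hT x y clxy; apply/fi/hT => A B Ax By.
by have [z [Az Bz]] := clxy _ _ (fc _ _ Ax) (fc _ _ By); exists (f z).
Qed.

Lemma hausdorff_set_type (T : topologicalType) (K : set T) :
  hausdorff_space T -> hausdorff_space (set_type K).
Proof.
apply: (@hausdorff_inj _ _ set_val); first exact: initial_continuous.
exact: val_inj.
Qed.

Lemma subcontinuumP (T : topologicalType) (K : set T) : hausdorff_space T ->
  subcontinuum K <-> [/\ K !=set0, connected K & compact K].
Proof.
move=> hT; split=> [[[x _] /connected_set_type ? /compact_set_type ? _]|].
  by split=> //; exists (val x); exact: set_valP.
move=> [[x Kx] ? ?]; split; last exact: hausdorff_set_type.
- by exists (SigSub (mem_set Kx)).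
- exact/connected_set_type.
- exact/compact_set_type.
Qed.

(** * Cuts of a space at a point *)

Definition cut_at (X : topologicalType) (x : X) (U V : set X) : Prop :=
  [/\ open U, open V, U `|` V = ~` [set x], U `&` V = set0
    & U !=set0 /\ V !=set0].

Lemma cutC (X : topologicalType) (x : X) U V : cut_at x U V -> cut_at x V U.
Proof. by case=> ? ? ? ? []; split=> //; rewrite (setUC, setIC). Qed.

Lemma cut_pointP (X : topologicalType) (x : X) :
  hausdorff_space X -> cut_point x -> exists U V, cut_at x U V.
Proof.
move=> hX /existsNP [B /not_implyP[B0 /not_implyP[[C oC BC]]]].
move=> /not_implyP[[D cD BD] BN].
have ox : open (~` [set x]).
  by apply/closed_openC/accessible_closed_set1/hausdorff_accessible.
(* [B] is the trace of both an open [C] and a closed [D]. Points being closed, the first makes [B]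
   open in [X], the second its complementary half. *)
exists B, (~` [set x] `&` ~` D); split.
- by rewrite BC; exact: openI.
- exact/openI/closed_openC.
- by rewrite BD -setIUr setUv setIT.
- by rewrite BD setIACA setICr setI0.
- split=> //; apply: contrapT => /nonemptyPn DD; apply: BN.
  rewrite BD; apply/setIidPl => y xy; apply: contrapT => Dy.
  by have : (~` [set x] `&` ~` D) y by []; rewrite DD.
Qed.

Section cut_lemmas.
Variables (X : topologicalType) (x : X) (U V : set X).
Hypothesis UVx : cut_at x U V.

Lemma cut_nl : ~ U x.
Proof.
case: UVx => _ _ UV _ _ Ux.
by have : (~` [set x]) x by [rewrite -UV; left]; apply.
Qed.

Lemma cut_disj y : U y -> V y -> False.
Proof. by case: UVx => _ _ _ UV _ Uy Vy; have : set0 y by rewrite -UV. Qed.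

Lemma cut_cover y : y <> x -> U y \/ V y.
Proof. by case: UVx => _ _ UV _ _ yx; have : (U `|` V) y by rewrite UV. Qed.

(** A clopen piece of this set that misses [x] is clopen in [X]: it is open as a relatively open
    part of [U], and closed because the whole set is the complement of [V]. Of two complementary
    pieces, one misses [x]. *)
Lemma cut_connected : connected [set: X] -> connected (x |` U).
Proof.
case: UVx => oU oV _ _ _ cX.
have ncl (B : set X) : B !=set0 -> open B -> ~ B x ->
    (exists2 D, closed D & B = (x |` U) `&` D) -> False.
  move=> [b Bb] oB nBx [D cD BD].
  apply: nBx; suff -> : B = setT by [].
  apply: cX; [by exists b|by exists B; rewrite ?setTI|].
  exists B; rewrite ?setTI// BD; apply: closedI => //.
  rewrite -[_ `|` _]setCK; apply: open_closedC.
  suff -> : ~` (x |` U) = V by [].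
  rewrite eqEsubset; split=> y.
    by move=> /not_orP[/= yx nUy]; case: (cut_cover yx).
  move=> Vy [/= yx|Uy]; last exact: cut_disj Uy Vy.
  case: UVx => _ _ UV _ _; have : (U `|` V) y by right.
  by rewrite UV; apply.
move=> B B0 [C oC BC] BD; apply: contrapT => BN.
have oU' (W : set X) : open W -> ~ W x -> open ((x |` U) `&` W).
  move=> oW nWx; suff -> : (x |` U) `&` W = U `&` W by exact: openI.
  rewrite eqEsubset; split=> y [Uy Wy]; split=> //; last by right.
  by case: Uy => // yx; rewrite yx in Wy.
(* [ncl] is applied to whichever of [B] and its relative complement misses [x]. *)
have [Bx|nBx] := pselect (B x); last first.
  apply: (ncl B) => //; rewrite BC; apply: oU' => // Cx; apply: nBx.
  by rewrite BC; split=> //; left.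
have [D cD BD'] := BD.
have xUDN : (x |` U) `&` ~` D !=set0.
  apply: contrapT => /nonemptyPn DD; apply: BN.
  rewrite BD'; apply/setIidPl => y Uy; apply: contrapT => Dy.
  by have : ((x |` U) `&` ~` D) y by []; rewrite DD.
apply: (ncl _ xUDN).
- apply: oU'; first exact: closed_openC.
  by rewrite BD' in Bx; case: Bx => _ Dx; apply.
- by rewrite BD' in Bx; case: Bx => _ Dx [_]; apply.
exists (~` C); first exact: open_closedC.
rewrite eqEsubset; split=> y [Uy ny]; split=> // ?; apply: ny.
  by have [] : ((x |` U) `&` D) y by rewrite -BD' BC; split.
by have [] : ((x |` U) `&` C) y by rewrite -BC BD'; split.
Qed.

End cut_lemmas.

(** The topology may be strictly finer than the order topology; this matches a continuous injection
    into an arc, as opposed to an embedding. *)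
Record open_ray_order (X : topologicalType) (lt : X -> X -> Prop) : Prop := {
  ray_irr : forall x, ~ lt x x;
  ray_trans : forall y x z, lt x y -> lt y z -> lt x z;
  ray_total : forall x y, x <> y -> lt x y \/ lt y x;
  open_lray : forall x, open [set y | lt y x];
  open_rray : forall x, open [set y | lt x y]
}.

Lemma open_ray_orderC (X : topologicalType) (lt : X -> X -> Prop) :
  open_ray_order lt -> open_ray_order (fun x y => lt y x).
Proof.
case=> irr tr tot ol or; split=> // [y x z xy yz|x y /tot[]]; last first.
- by left.
- by right.
- exact: tr yz xy.
Qed.

Lemma ray_asym (X : topologicalType) (lt : X -> X -> Prop) x y :
  open_ray_order lt -> lt x y -> lt y x -> False.
Proof. by move=> o xy yx; apply: (ray_irr o (x := x)); exact: ray_trans yx. Qed.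

(* If [x] were minimal, both halves of a cut at [x] would be connected and
   contain [x], so one of them would meet every point below a given point of the
   other half. *)
Lemma cut_not_min (X : topologicalType) (lt : X -> X -> Prop) (x : X) :
  connected [set: X] -> open_ray_order lt -> (exists U V, cut_at x U V) ->
  exists y, lt y x.
Proof.
move=> cX o [U [V UV]]; apply: contrapT => /forallNP xmin.
have key (A B : set X) a b : cut_at x A B -> A a -> B b -> lt a b -> False.
  move=> AB Aa Bb ab.
  have Bc := cut_connected (cutC AB) cX.
  suff /(_ b (or_intror Bb)) : x |` B `<=` [set y | lt y a].
    by apply: ray_asym o ab.
  apply: connected_sub_open Bc (open_lray o a) (open_rray o a) _ _ _.
  - move=> y xBy; apply: (ray_total o) => ya; rewrite ya in xBy.
    case: xBy => [/= ax|/(cut_disj AB Aa)//].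
    by apply: (cut_nl AB); rewrite -ax.
  - by move=> y _; exact: ray_asym.
  - exists x; split; first by left.
    have [/= ax|//|/xmin//] := ray_total o (x := x) (y := a).
    by apply: (cut_nl AB); rewrite ax.
case: (UV) => _ _ _ _ [[a Ua] [b Vb]].
have [ab|ab|ba] := ray_total o (x := a) (y := b).
- by apply: (cut_disj UV Ua); rewrite ab.
- exact: (key U V a b).
- exact: (key V U b a (cutC UV)).
Qed.

(** * The arc of open lower sets *)

Lemma nbhs_order_itv d (T : orderTopologicalType d) (s : T) (A : set T) :
  nbhs s A -> exists l r : itv_bound T, [/\ itv_open_ends (Interval l r),
    (l <= BLeft s)%O, (BRight s <= r)%O &
    forall x, (l <= BLeft x)%O -> (BRight x <= r)%O -> A x].
Proof.
rewrite itv_nbhsE => -[[l r] [oi /andP[ls sr]] iA].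
by exists l, r; split=> // x lx xr; apply/iA/andP.
Qed.

(** Open rays form a subbase of the order topology; an infinite bound imposes no condition. *)
Lemma cvg_order_rays d (T : orderTopologicalType d) (F : set_system T) (s : T) :
  Filter F -> (forall t, (s < t)%O -> F [set x | (x < t)%O]) ->
  (forall t, (t < s)%O -> F [set x | (t < x)%O]) -> F --> s.
Proof.
move=> FF Fl Fr A /nbhs_order_itv[l [r [oi ls sr lrA]]].
suff [Fl' Fr'] : F [set x | (l <= BLeft x)%O] /\ F [set x | (BRight x <= r)%O].
  by apply: filterS2 Fl' Fr' => x /= lx xr; exact: lrA.
split=> {lrA}.
  case: l ls oi => [b t + /itv_open_ends_lside bE|b _ /itv_open_ends_linfty ->].
    by rewrite bE !bnd_simp => /Fr.
  exact: filterE.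
case: r sr oi => [b t + /itv_open_ends_rside bE|b _ /itv_open_ends_rinfty ->].
  by rewrite bE !bnd_simp => /Fl.
exact: filterE.
Qed.

Section lower_sets.
Variables (X : topologicalType) (lt : X -> X -> Prop).

(* The unused parameter [o] lets instance inference find the proof that inclusion
   is a total order. *)
Record open_lower_set (o : open_ray_order lt) := OpenLowerSet {
  lower_set : set X;
  lower_set_open : open lower_set;
  lower_set_lower : forall x y, lower_set y -> lt x y -> lower_set x }.

Variable o : open_ray_order lt.
Notation L := (open_lower_set o).

Lemma lower_set_inj : injective (@lower_set o).
Proof.
move=> [I oI lI] [J oJ lJ] /= IJ; case: _ / IJ oJ lJ => oJ lJ.
by congr OpenLowerSet; exact: Prop_irrelevance.
Qed.

HB.instance Definition _ := gen_eqMixin L.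
HB.instance Definition _ := gen_choiceMixin L.

Definition lower_le (I J : L) : bool := `[< lower_set I `<=` lower_set J >].

Lemma lower_le_refl : reflexive lower_le.
Proof. by move=> I; exact/asboolP. Qed.

Lemma lower_le_anti : antisymmetric lower_le.
Proof.
move=> I J /andP[/asboolP IJ /asboolP JI].
by apply: lower_set_inj; rewrite eqEsubset.
Qed.

Lemma lower_le_trans : transitive lower_le.
Proof.
by move=> J I K /asboolP IJ /asboolP JK; apply/asboolP; exact: subset_trans JK.
Qed.

(** A point of [I] outside [J] lies above every point of [J], so [I] contains [J]. *)
Lemma lower_le_total : total lower_le.
Proof.
move=> I J; have [IJ|] := pselect (lower_set I `<=` lower_set J).
  by apply/orP; left; apply/asboolP.
move=> /existsNP[x /not_implyP[Ix nJx]]; apply/orP; right.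
apply/asboolP => y Jy.
have [|/(lower_set_lower Ix)//|xy] := ray_total o (x := y) (y := x).
  by move=> yx; rewrite yx in Jy.
by case: nJx; exact: lower_set_lower xy.
Qed.

Fact lower_display : Order.disp_t. Proof. exact: Order.Disp tt tt. Qed.

HB.instance Definition _ := Order.Le_isPOrder.Build lower_display L
  lower_le_refl lower_le_anti lower_le_trans.
HB.instance Definition _ :=
  Order.POrder_isTotal.Build lower_display L lower_le_total.

End lower_sets.
Arguments OpenLowerSet {X lt o}.

(** * Compactness and connectedness of the space of open lower sets *)

Section lower_set_arc.
Variables (X : topologicalType) (lt : X -> X -> Prop).
Variable o : open_ray_order lt.
Let L : orderTopologicalType _ := order_topology (open_lower_set o).

Lemma lower_leP (I J : L) : (I <= J)%O <-> lower_set I `<=` lower_set J.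
Proof. by split=> /asboolP. Qed.

Lemma lower_ltP (I J : L) :
  (I < J)%O <-> exists2 x, lower_set J x & ~ lower_set I x.
Proof.
rewrite ltNge; split=> [/negP JI|[x Jx nIx]].
  have /existsNP[x /not_implyP[]] : ~ lower_set J `<=` lower_set I.
    by move=> /lower_leP.
  by exists x.
by apply/negP => /lower_leP/(_ x Jx).
Qed.

Lemma bigcup_lower (P : set L) :
  open (\bigcup_(I in P) lower_set I) /\
  (forall x y, (\bigcup_(I in P) lower_set I) y -> lt x y ->
    (\bigcup_(I in P) lower_set I) x).
Proof.
split; first by apply: bigcup_open => I _; exact: lower_set_open.
by move=> x y [I PI Iy] xy; exists I => //; exact: lower_set_lower xy.
Qed.

(** The empty set and the whole space count as open lower sets, so the order is complete, with
    unions as suprema. *)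
Definition lower_sup (P : set L) : L :=
  OpenLowerSet _ (bigcup_lower P).1 (bigcup_lower P).2.

(* An ultrafilter converges to the supremum of the [J] such that [`[J, +oo[]
   belongs to it. *)
Lemma lower_set_compact : compact [set: L].
Proof.
rewrite compact_ultra => F FU _.
pose P := [set J : L | F [set K | (J <= K)%O]].
exists (lower_sup P); split=> //.
apply: cvg_order_rays => J.
  move=> /lower_ltP[x Jx nPx].
  have [//|FJ] := in_ultra_setVsetC [set K | (K < J)%O] FU.
  case: nPx; exists J => //; apply: filterS FJ => K /=.
  by rewrite leNgt => /negP.
move=> /lower_ltP[x [K PK Kx] nJx]; apply: filterS PK => M /=.
by apply: lt_le_trans; apply/lower_ltP; exists x.
Qed.

Lemma lray_lower x : open [set y | lt y x] /\
  forall y z, lt z x -> lt y z -> lt y x.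
Proof.
split; first exact: open_lray.
by move=> y z zx yz; exact: ray_trans zx.
Qed.

Definition lray (x : X) : L := OpenLowerSet _ (lray_lower x).1 (lray_lower x).2.

Lemma lray_inj : injective lray.
Proof.
move=> x y xy; apply: contrapT => /(ray_total o) xyN.
have E z : lt z x <-> lt z y.
  by rewrite -[lt z x]/(lower_set (lray x) z) xy.
by case: xyN => [/E|/E] /(ray_irr o).
Qed.

(** [x] is missing from its own ray and so witnesses strictness. Conversely, a point of [I] outside
    the ray is [x] or lies above it. *)
Lemma lray_gt (x : X) (I : L) : (lray x < I)%O <-> lower_set I x.
Proof.
rewrite lower_ltP; split=> [[y Iy nyx]|Ix].
  have [<-//|] := pselect (y = x).
  move=> /(ray_total o)[//|xy]; exact: lower_set_lower xy.
by exists x => //; exact: ray_irr.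
Qed.

Lemma lray_lt (x : X) (I : L) :
  (I < lray x)%O <-> exists2 y, ~ lower_set I y & lt y x.
Proof. by rewrite lower_ltP; split=> -[y ? ?]; exists y. Qed.

(** The ray below [I] pulls back to [I] itself, the ray above [I] to a union of final rays of [X];
    both are open. *)
Lemma lray_continuous : continuous lray.
Proof.
move=> x; apply: cvg_order_rays => I.
  move=> /lray_gt Ix; apply: (@filterS _ _ _ (lower_set I)).
    by move=> y /lray_gt.
  by apply: open_nbhs_nbhs; split=> //; exact: lower_set_open.
move=> /lray_lt[y nIy yx]; apply: (@filterS _ _ _ [set z | lt y z]).
  by move=> z yz; apply/lray_lt; exists y.
by apply: open_nbhs_nbhs; split=> //; exact: open_rray.
Qed.

Hypotheses (X0 : [set: X] !=set0) (cX : connected [set: X]).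
Hypothesis nomax : forall x, exists y, lt x y.

(** If [x] were the maximum of [I], then [I] and the final ray at [x], nonempty by [nomax], would
    disconnect [X]. *)
Lemma lower_set_nomax (I : L) x : lower_set I x ->
  exists2 y, lower_set I y & lt x y.
Proof.
move=> Ix; apply: contrapT => /forall2NP Imax.
have [y xy] := nomax x.
suff IT : [set: X] `<=` lower_set I by case: (Imax y) => //; apply; exact: IT.
apply: connected_sub_open cX (lower_set_open I) (open_rray o x) _ _ _.
- move=> z _; have [->|] := pselect (z = x); first by left.
  by move=> /(ray_total o)[zx|]; [left; exact: lower_set_lower zx|right].
- by move=> z _; case: (Imax z).
- by exists x.
Qed.

(** This gives connectedness of the arc, as the closure of a continuous image of [X]. *)
Lemma lray_dense : closure (range lray) = setT.
Proof.
rewrite eqEsubset; split=> // I _ A /nbhs_order_itv[l [r [oi lI Ir lrA]]].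
suff [x lx xr] :
    exists2 x : X, (l <= BLeft (lray x))%O & (BRight (lray x) <= r)%O.
  exists (lray x); split; first by exists x.
  exact: lrA.
case: l lI oi {lrA} => [b J + oi|b _ oi].
  rewrite (itv_open_ends_lside oi) bnd_simp => /lower_ltP[x Ix nJx].
  (* The ray at [x] may equal [J]; the ray at a further point [y] of [I] contains [x] and is
     strictly larger than [J]. *)
  have [y Iy xy] := lower_set_nomax Ix.
  exists y; first by rewrite bnd_simp; apply/lray_lt; exists x.
  case: r Ir oi => [c K + oi|c _ oi].
    rewrite (itv_open_ends_rside oi) !bnd_simp => /ltW IK.
    by apply/lray_gt; exact: (iffLR (lower_leP I K) IK).
  by rewrite (itv_open_ends_rinfty oi).
rewrite (itv_open_ends_linfty oi); case: r Ir oi => [c K + oi|c _ oi].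
  rewrite (itv_open_ends_rside oi) bnd_simp => /lower_ltP[x Kx _].
  by exists x => //; rewrite bnd_simp; apply/lray_gt.
by rewrite (itv_open_ends_rinfty oi); case: X0 => x _; exists x.
Qed.

Lemma lower_set_arc : hausdorff_arc L.
Proof.
split; last exact: order_hausdorff.
- by case: X0 => x _; exists (lray x).
- rewrite -lray_dense; apply/connected_closure/connected_continuous_connected.
    exact: cX.
  exact/continuous_subspaceT/lray_continuous.
- exact: lower_set_compact.
Qed.

End lower_set_arc.

Lemma open_ray_order_weakly_orderable (X : topologicalType)
    (lt : X -> X -> Prop) :
  [set: X] !=set0 -> connected [set: X] -> (forall x, exists y, lt x y) ->
  open_ray_order lt -> weakly_orderable X.
Proof.
move=> X0 cX nomax o.
exists lower_display, (order_topology (open_lower_set o)), (lray o); split.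
- exact: lower_set_arc.
- exact: lray_continuous.
- exact: lray_inj.
Qed.

Lemma weakly_orderable_open_ray_order (X : topologicalType) :
  weakly_orderable X -> exists lt : X -> X -> Prop, open_ray_order lt.
Proof.
move=> [d [L [f [_ fc fi]]]]; exists (fun x y => (f x < f y)%O); split.
- by move=> x; rewrite ltxx.
- by move=> y x z; exact: lt_trans.
- by move=> x y xy; apply/orP/lt_total/eqP => /fi.
- move=> x; have /continuousP/(_ _ (lray_open (f x))) := fc.
  by rewrite set_itvE.
- move=> x; have /continuousP/(_ _ (rray_open (f x))) := fc.
  by rewrite set_itvE.
Qed.

(** * Cuts in the Stone-Cech compactification *)

(** The properties of the compactification on which the cut arguments rest; the extension property
    is what keeps the two sides of a cut apart. *)
Record stone_cech_spec (R : realType) (X Z : topologicalType) (e : X -> Z) :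
    Prop := {
  sc_continuous : continuous e;
  sc_inj : injective e;
  sc_dense : closure (range e) = setT;
  sc_compact : compact [set: Z];
  sc_hausdorff : hausdorff_space Z;
  sc_extend : forall h : X -> R, continuous h -> (forall x, 0 <= h x <= 1) ->
    exists2 H : Z -> R, continuous H & forall x, H (e x) = h x;
  sc_separate : forall z w : Z, z <> w -> exists2 G : Z -> R,
    continuous G & (forall t, 0 <= G t <= 1) /\ G z <> G w
}.

Lemma continuous_at_open_eq (S T : topologicalType) (f g : S -> T) (O : set S)
    (s : S) : open O -> O s -> (forall t, O t -> f t = g t) ->
  {for s, continuous g} -> {for s, continuous f}.
Proof.
move=> oO Os fg gs A; rewrite /= fg// => /gs.
move=> gA; have gA' : nbhs s (g @^-1` A) by exact: gA.
suff : nbhs s (f @^-1` A) by [].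
have nO : nbhs s O by exact: open_nbhs_nbhs.
by apply: filterS2 gA' nO => t gAt Ot; rewrite /preimage/= fg.
Qed.

Lemma closure_eq_fun (R : realType) (Z : topologicalType) (f g : Z -> R)
    (A : set Z) : continuous f -> continuous g ->
  (forall z, A z -> f z = g z) -> forall z, closure A z -> f z = g z.
Proof.
move=> fc gc fg z Az.
have cl : closed [set t | f t - g t = 0].
  apply: (@closed_comp _ _ (fun t => f t - g t) [set 0]) => //.
    by move=> t _; apply: cvgB; [exact: fc|exact: gc].
apply/eqP; rewrite -subr_eq0; apply/eqP.
by apply: cl; apply: closureS Az => t /fg /= ->; rewrite subrr.
Qed.

Section compactification.
Variables (R : realType) (X Z : topologicalType) (e : X -> Z).
Hypothesis sc : stone_cech_spec R e.
Implicit Types (x y : X) (U V : set X).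

(* A function that vanishes near [x] can be replaced by [0] on [V]; its
   extension separates [closure (e @` U)] from [closure (e @` V)] away from
   [e x]. *)
Lemma closure_cutI x U V z : cut_at x U V ->
  closure (e @` U) z -> closure (e @` V) z -> z = e x.
Proof.
move=> UV Uz Vz; apply: contrapT => /(sc_separate sc)[G Gc [G01 Gzx]].
(* Half the gap: [phi] vanishes where [G] is within [d] of [G (e x)], while [phi z = d] is
   positive. *)
pose d := `|G z - G (e x)| / 2.
have d0 : 0 < d by rewrite divr_gt0// normr_gt0 subr_eq0; exact/eqP.
pose phi w := Num.max 0 (`|G w - G (e x)| - d).
have phic : continuous phi.
  move=> w.
  apply: (@continuous_max R Z (cst 0) (fun w => `|G w - G (e x)| - d)).
    exact: cvg_cst.
  apply: cvgB; last exact: cvg_cst.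
  apply: cvg_norm; apply: cvgB; last exact: cvg_cst.
  exact: Gc.
pose h y := if pselect (U y) then phi (e y) else 0.
have ec := sc_continuous sc.
have phiec : continuous (phi \o e).
  by move=> y; apply: continuous_comp; [exact: ec|exact: phic].
have hc : continuous h.
  move=> y; have [Uy|nUy] := pselect (U y).
    apply: (@continuous_at_open_eq _ _ h (phi \o e) U) => //.
    - by case: UV.
    - by move=> t Ut; rewrite /h; case: pselect.
    - exact: phiec.
  (* [h] is zero on this open set: on [V] by definition, near [x] because [phi] vanishes there. It
     contains every point outside [U]. *)
  pose W := V `|` (e @^-1` (G @^-1` (ball (G (e x)) d))).
  have oW : open W.
    apply: openU; first by case: UV.
    apply: open_comp; first by move=> t _; exact: ec.
    apply: open_comp; first by move=> t _; exact: Gc.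
    exact: ball_open.
  have Wy : W y.
    have [->|yx] := pselect (y = x); first by right; exact: ballxx.
    by case: (cut_cover UV yx) => //; left.
  apply: (@continuous_at_open_eq _ _ h (cst 0) W) => //; last exact: cvg_cst.
  move=> t [Vt|]; rewrite /h; case: pselect => //= Ut.
    by case: (cut_disj UV Ut Vt).
  rewrite /ball/= distrC => /ltW; rewrite -subr_le0 /phi => ?.
  by apply/max_idPl.
have [H Hc He] : exists2 H : Z -> R, continuous H & forall x, H (e x) = h x.
  apply: (sc_extend sc) => // y; rewrite /h; case: pselect => Uy; last first.
    by rewrite lexx ler01.
  have G1 : `|G (e y) - G (e x)| <= 1.
    have /andP[y0 y1] := G01 (e y); have /andP[x0 x1] := G01 (e x).
    by rewrite ler_norml; apply/andP; split; lra.
  rewrite /phi le_max lexx/= ge_max ler01/= lerBlDr (le_trans G1)//.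
  by rewrite lerDl ltW.
(* [H] is zero on the image of [V] and agrees with [phi] on that of [U]. Both identities pass to the
   closures, forcing [phi z = 0]. *)
have Hz0 : H z = 0.
  apply: (closure_eq_fun Hc _ _ Vz); first exact: cst_continuous.
  move=> _ [y Vy <-]; rewrite He /h; case: pselect => // Uy.
  by case: (cut_disj UV Uy Vy).
have : H z = phi z.
  apply: (closure_eq_fun Hc phic _ Uz) => _ [y Uy <-].
  by rewrite He /h; case: pselect.
rewrite Hz0 /phi => /esym/max_idPl; rewrite subr_le0 leNgt => /negP; apply.
by rewrite /d ltr_pdivrMr// ltr_pMr ?ltr1n// normr_gt0 subr_eq0; exact/eqP.
Qed.

Lemma closure_cut_cover x U V z : cut_at x U V ->
  [\/ z = e x, closure (e @` U) z | closure (e @` V) z].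
Proof.
move=> UV; have : closure (range e) z by rewrite (sc_dense sc).
have -> : range e = [set e x] `|` (e @` U `|` e @` V).
  rewrite -image_setU -[[set e x]](image_set1 e x) -image_setU; congr image.
  by case: UV => _ _ -> _ _; rewrite setUv.
rewrite !closureU => -[|[Uz|Vz]]; [|exact: Or32|exact: Or33].
rewrite -(closure_id _).1; first by move=> ->; exact: Or31.
exact/accessible_closed_set1/hausdorff_accessible/(sc_hausdorff sc).
Qed.

(** * From an order with open rays to irreducibility *)

Lemma sc_continuum : [set: X] !=set0 -> connected [set: X] -> continuum Z.
Proof.
move=> [x _] cX; split; first by exists (e x).
- rewrite -(sc_dense sc).
  apply/connected_closure/connected_continuous_connected => //.
  exact: continuous_subspaceT (sc_continuous sc).
- exact: sc_compact sc.
- exact: sc_hausdorff sc.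
Qed.

(** The initial rays are nested and nonempty, so their images generate a proper filter, which
    clusters in the compact space [Z]. *)
Lemma ray_order_end (lt : X -> X -> Prop) : [set: X] !=set0 ->
  open_ray_order lt -> (forall x, exists y, lt y x) ->
  exists p, forall x, closure (e @` [set y | lt y x]) p.
Proof.
move=> [x0 _] o nomin.
pose F := filter_from [set: X] (fun x => e @` [set y | lt y x]).
have PF : ProperFilter F.
  apply: filter_from_proper; last first.
    by move=> x _; have [y yx] := nomin x; exists (e y); exists y.
  apply: filter_from_filter; first by exists x0.
  move=> x y _ _; have [z zxy] : exists z, forall t, lt t z -> lt t x /\ lt t y.
    have [<-|/(ray_total o)[xy|yx]] := pselect (x = y).
    - by exists x.
    - by exists x => t tx; split=> //; exact: ray_trans xy.
    - by exists y => t ty; split=> //; exact: ray_trans yx.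
  by exists z => // _ [t /zxy[tx ty] <-]; split; exists t.
have [p [_ pF]] := sc_compact sc PF filterT.
exists p => x; move: pF; rewrite clusterE; apply.
by exists x.
Qed.

Lemma open_ray_order_cut (lt : X -> X -> Prop) x : open_ray_order lt ->
  (exists y, lt y x) -> (exists y, lt x y) ->
  cut_at x [set y | lt y x] [set y | lt x y].
Proof.
move=> o nomin nomax; split=> //.
- exact: open_lray.
- exact: open_rray.
- rewrite eqEsubset; split=> y; last by move=> /(ray_total o).
  by move=> yx /= E; rewrite E in yx; case: yx => /(ray_irr o).
- by rewrite -subset0 => y [/= yx /(ray_asym o yx)].
Qed.

Lemma open_ray_order_irreducible (lt : X -> X -> Prop) : [set: X] !=set0 ->
  connected [set: X] -> open_ray_order lt ->
  (forall x, exists y, lt y x) -> (forall x, exists y, lt x y) ->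
  irreducible_continuum Z.
Proof.
move=> X0 cX o nomin nomax; split; first exact: sc_continuum.
have hZ := sc_hausdorff sc.
have [p pP] := ray_order_end X0 o nomin.
have [q qP] := ray_order_end X0 (open_ray_orderC o) nomax.
exists p, q => K /(subcontinuumP _ hZ)[_ cK coK] Kp Kq.
(* [K] is closed and the image of [X] dense, so it is enough that [K] contains every [e x]. *)
rewrite eqEsubset; split=> //; rewrite -(sc_dense sc).
rewrite (closure_id K).1; last exact: compact_closed.
apply: closureS => _ [x _ <-]; apply: contrapT => nKx.
have UV := open_ray_order_cut o (nomin x) (nomax x).
set A := closure (e @` [set y | lt y x]).
set B := closure (e @` [set y | lt x y]).
have AB z : K z -> A z -> B z -> False.
  by move=> Kz Az Bz; apply: nKx; rewrite -(closure_cutI UV Az Bz).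
have /(_ q Kq) : K `<=` ~` B; last by apply; exact: qP.
(* As [K] misses [e x], each of its points lies in exactly one of [A] and [B]. So the complements of
   [B] and [A] separate [K], and [p] puts [K] in the first, against [q]. *)
apply: (connected_sub_open (V := ~` A)) cK _ _ _ _ _.
- exact/closed_openC/closed_closure.
- exact/closed_openC/closed_closure.
- move=> z Kz; have [Az|] := pselect (A z); last by right.
  by left; exact: AB.
- move=> z Kz nBz nAz; have [zx|//|//] := closure_cut_cover z UV.
  by apply: nKx; rewrite -zx.
- exists p; split=> //; apply: AB => //; exact: pP.
Qed.

(** * From irreducibility to an order with open rays *)

Section irreducible.
Hypothesis cX : connected [set: X].
(** Adding [x] makes each half of a cut the closure of a connected set, hence a subcontinuum. *)
Let half x U := closure (e @` (x |` U)).

Let halfE x U z : half x U z -> z = e x \/ closure (e @` U) z.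
Proof.
rewrite /half image_setU closureU image_set1 -(closure_id _).1//.
exact/accessible_closed_set1/hausdorff_accessible/(sc_hausdorff sc).
Qed.

Let half_cover x U V z : cut_at x U V -> half x U z \/ half x V z.
Proof.
move=> UV; have [->|Uz|Vz] := closure_cut_cover z UV.
- by left; apply: subset_closure; exists x => //; left.
- by left; apply: closureS Uz; apply: image_subset => ? ?; right.
- by right; apply: closureS Vz; apply: image_subset => ? ?; right.
Qed.

Let halfI x U V z : cut_at x U V -> half x U z -> half x V z -> z = e x.
Proof.
by move=> UV /halfE[//|Uz] /halfE[//|Vz]; exact: closure_cutI UV Uz Vz.
Qed.

(** By irreducibility such a half would be all of [Z]. Then a point of [V] would have its image in
    both halves and so equal [x]. *)
Let half_pq p q x U V : cut_at x U V ->
  irreducible_between p q -> half x U p -> half x U q -> False.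
Proof.
move=> UV pq Up Uq; have hZ := sc_hausdorff sc.
have UT : half x U = setT.
  apply: pq => //; apply/subcontinuumP => //; split; first by exists p.
    apply/connected_closure/connected_continuous_connected.
      exact: cut_connected UV cX.
    exact: continuous_subspaceT (sc_continuous sc).
  by apply: (subclosed_compact _ (sc_compact sc)) => //; exact: closed_closure.
have [_ _ _ _ [_ [v Vv]]] := UV.
have evx : e v = e x.
  apply: (halfI UV); first by rewrite UT.
  by apply: subset_closure; exists v => //; right.
by apply: (cut_nl (cutC UV)); rewrite -(sc_inj sc evx).
Qed.

Definition oriented_cut p q x U V := [/\ cut_at x U V, half x U p & half x V q].

Let oriented_cutC p q x U V : oriented_cut p q x U V -> oriented_cut q p x V U.
Proof. by case=> /cutC. Qed.

Let oriented_cutP p q x : irreducible_between p q ->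
  (exists U V, cut_at x U V) -> exists U V, oriented_cut p q x U V.
Proof.
move=> pq [U [V UV]]; have VU := cutC UV.
have [Up|Vp] := half_cover p UV.
  exists U, V; split=> //; have [Uq|//] := half_cover q UV.
  by case: (half_pq UV pq Up Uq).
exists V, U; split=> //; have [Vq|//] := half_cover q VU.
by case: (half_pq VU pq Vp Vq).
Qed.

(** The union of [V'] and [y] is connected and misses [x], so it lies in [U] or in [V]. In [U] it
    would bring [q] into the half of [p]. *)
Let oriented_sub p q x U V y U' V' : irreducible_between p q ->
  oriented_cut p q x U V -> oriented_cut p q y U' V' ->
  U' x -> y |` V' `<=` V.
Proof.
move=> pq [UV Up Vq] [UV' Up' Vq'] U'x.
have UVcover z : (y |` V') z -> U z \/ V z.
  move=> yVz; apply: (cut_cover UV) => zx; rewrite zx in yVz.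
  case: yVz => [/= xy|/(cut_disj UV' U'x)//].
  by apply: (cut_nl UV'); rewrite -xy.
have [oU oV _ _ _] := UV.
have cV' := cut_connected (cutC UV') cX.
have [Vy|nVy] := pselect (V y).
  apply: connected_sub_open cV' oV oU _ _ _.
  - by move=> z /UVcover[]; [right|left].
  - by move=> z _ Vz Uz; exact: (cut_disj UV Uz Vz).
  - by exists y; split=> //; left.
exfalso; apply: (half_pq UV pq Up); apply: closureS Vq'; apply: image_subset.
suff : y |` V' `<=` U by move=> VU z /VU; right.
apply: connected_sub_open cV' oU oV _ _ _ => //.
- by move=> z _ Uz Vz; exact: (cut_disj UV Uz Vz).
- by exists y; split; [left|case: (UVcover y) => //; left].
Qed.

Lemma irreducible_open_ray_order (p q : Z) : irreducible_between p q ->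
  (forall x, exists U V, cut_at x U V) ->
  exists lt : X -> X -> Prop, open_ray_order lt.
Proof.
move=> pq cuts.
(* Exchanging [p] and [q] swaps the sides of every cut, so [oriented_sub] yields the inclusions for
   both sides. *)
have qp : irreducible_between q p by move=> K cK Kq Kp; exact: pq.
have /choice[UV UVP] x :
    exists UV : set X * set X, oriented_cut p q x UV.1 UV.2.
  by have [U [V ?]] := oriented_cutP pq (cuts x); exists (U, V).
pose U x := (UV x).1; pose V x := (UV x).2.
have UVC x : cut_at x (U x) (V x) by case: (UVP x).
have UsubV x y : U y x -> y |` V y `<=` V x.
  exact: (oriented_sub pq (UVP x) (UVP y)).
have VsubU x y : V y x -> y |` U y `<=` U x.
  exact: (oriented_sub qp (oriented_cutC (UVP x)) (oriented_cutC (UVP y))).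
(* Each direction evaluates an inclusion at the point of its cut. The final ray at [x] is thus the
   open set [V x], and totality follows from the covering by a cut. *)
have UVE x y : U y x <-> V x y.
  by split=> [/UsubV|/VsubU]; apply; left.
exists (fun x y => U y x); split.
- by move=> x; exact: cut_nl (UVC x).
- by move=> y x z Uyx /UVE/VsubU; apply; right.
- move=> x y xy; have [Uyx|/UVE Uxy] := cut_cover (UVC y) xy; by [left|right].
- by move=> x; case: (UVC x).
- move=> x; have -> : [set y | U y x] = V x.
    by rewrite eqEsubset; split=> y /UVE.
  by case: (UVC x).
Qed.

End irreducible.
End compactification.

(** * The concrete compactification *)

Section stone_cech_is_spec.
Variables (R : realType) (X : topologicalType).
Notation I01 := (unit_interval R).
Notation C := (continuousType X I01).
Notation cube := (prod_topology (fun _ : C => I01)).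

Definition to_unit_interval (h : X -> R) (h01 : forall x, 0 <= h x <= 1) :
    X -> I01 :=
  fun x => SigSub (mem_set (h01 x : `[0, 1]%classic (h x))).

Lemma to_unit_interval_continuous h h01 : continuous h ->
  continuous (@to_unit_interval h h01).
Proof.
move=> hc; apply/continuousP => _ [A oA <-].
by move/continuousP : hc => /(_ A oA).
Qed.

Lemma unit_interval_mkcts (h : X -> R) : continuous h ->
  (forall x, 0 <= h x <= 1) -> exists c : C, forall x, val (c x) = h x.
Proof.
move=> hc h01; exists (mkcts (to_unit_interval_continuous (h01 := h01) hc)).
by [].
Qed.

Lemma cube_compact : compact [set: cube].
Proof.
have := @tychonoff C (fun _ => I01) (fun _ => setT).
suff -> : [set: cube] = [set f : cube | forall c, [set: I01] (f c)].
  by apply=> _; apply/compact_set_type; exact: segment_compact.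
by rewrite eqEsubset; split.
Qed.

Lemma cube_hausdorff : hausdorff_space cube.
Proof.
apply: hausdorff_product => _; exact/hausdorff_set_type/Rhausdorff.
Qed.

Lemma stone_cech_eval_continuous : continuous (@stone_cech_eval R X).
Proof.
move=> x; apply/cvg_sup => c.
move: x; apply/(@continuousP _ (initial_topology (@^~ c))) => A [B oB <-].
by have /continuousP := @cts_fun _ _ c; apply.
Qed.

Definition to_stone_cech (x : X) : stone_cech R X :=
  SigSub (mem_set (subset_closure (imageT (@stone_cech_eval R X) x))).

Definition stone_cech_coord (c : C) (z : stone_cech R X) : R :=
  val ((val z : cube) c).

Lemma stone_cech_coord_continuous c : continuous (stone_cech_coord c).
Proof.
move=> z; apply: (@continuous_comp (stone_cech R X) I01 R
  (fun z => (set_val z : cube) c) set_val).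
  apply: (@continuous_comp (stone_cech R X) cube I01 set_val (proj c)).
    exact: initial_continuous.
  exact: proj_continuous.
exact: initial_continuous.
Qed.

Lemma stone_cech_coord01 c z : 0 <= stone_cech_coord c z <= 1.
Proof. exact: (set_valP ((val z : cube) c)). Qed.

(** A continuous function to the unit interval is itself an index of the cube, so the coordinate it
    indexes extends it. Complete regularity gives a coordinate that tells two given points of [X]
    apart. *)
Lemma tychonoff_stone_cech : tychonoff_space X ->
  stone_cech_spec R to_stone_cech.
Proof.
move=> [crX hX]; split.
- apply/continuousP => _ [A oA <-].
  by have /continuousP := stone_cech_eval_continuous; apply.
- move=> x y exy; apply: contrapT => xy.
  have /uniform_separatorP : uniform_separator [set x] [set y].
    by apply: crX => //; exact/accessible_closed_set1/hausdorff_accessible.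
  move=> /(_ R)[f [fc f01 f0 f1]].
  have [c cE] : exists c : C, forall x, val (c x) = f x.
    by apply: unit_interval_mkcts => // t; apply: f01; exists t.
  have fx0 : f x = 0 by apply: f0; exists x.
  have fy1 : f y = 1 by apply: f1; exists y.
  have : stone_cech_coord c (to_stone_cech x) =
      stone_cech_coord c (to_stone_cech y).
    by rewrite exy.
  have -> : stone_cech_coord c (to_stone_cech x) = f x by exact: cE.
  have -> : stone_cech_coord c (to_stone_cech y) = f y by exact: cE.
  by rewrite fx0 fy1 => /esym/eqP; rewrite oner_eq0.
- rewrite eqEsubset; split=> // z _ A [_ [[B oB <-] Bz BA]].
  have zB : nbhs (val z) B by apply: open_nbhs_nbhs; split.
  have [_ [[x _ <-] Bx]] := set_valP z _ zB.
  by exists (to_stone_cech x); split; [exists x|exact: BA].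
- apply/compact_set_type.
  by apply: (subclosed_compact _ cube_compact) => //; exact: closed_closure.
- exact/hausdorff_set_type/cube_hausdorff.
- move=> h hc h01; have [c cE] := unit_interval_mkcts hc h01.
  exists (stone_cech_coord c); first exact: stone_cech_coord_continuous.
  exact: cE.
- move=> z w zw.
  have [c zwc] : exists c : C, (val z : cube) c <> (val w : cube) c.
    apply: contrapT => /forallNP zwE; apply/zw/val_inj.
    by apply: functional_extensionality_dep => c; apply: contrapT; exact: zwE.
  exists (stone_cech_coord c); first exact: stone_cech_coord_continuous.
  by split; [exact: stone_cech_coord01|move=> /val_inj/zwc].
Qed.

End stone_cech_is_spec.

Theorem corollary3p5 (R : realType) (X : topologicalType)
    (tychonoffX : tychonoff_space X) (cutX : cut_point_space X) :
  weakly_orderable X <-> irreducible_continuum (stone_cech R X).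
Proof.
have [X0 cX cuts] := cutX; have [_ hX] := tychonoffX.
have cutsX (x : X) : exists U V, cut_at x U V.
  exact: (cut_pointP hX (cuts x)).
have sc := tychonoff_stone_cech R tychonoffX.
have nomin (lt : X -> X -> Prop) (o : open_ray_order lt) x : exists y, lt y x.
  exact: cut_not_min o (cutsX x).
have nomax (lt : X -> X -> Prop) (o : open_ray_order lt) x : exists y, lt x y.
  exact: cut_not_min (open_ray_orderC o) (cutsX x).
split=> [/weakly_orderable_open_ray_order[lt o]|[_ [p [q pq]]]].
  exact: open_ray_order_irreducible sc lt X0 cX o (nomin _ o) (nomax _ o).
have [lt o] := irreducible_open_ray_order sc cX pq cutsX.
exact: open_ray_order_weakly_orderable X0 cX (nomax _ o) o.
Qed.
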